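(* If a $v_3$ configuration has a proper $n_3$ subconfiguration, then it has a proper $(v-n)_3$ subconfiguration.
   Context: A $w_3$ configuration is a set system consisting of $w$ lines, each a 3-subset of the point set, such that any two points lie in at most one common line and every point lies in exactly three lines (it then has exactly $w$ points). An $n_3$ subconfiguration of a $v_3$ configuration is a subset of its lines which, together with the union of these lines as point set, is an $n_3$ configuration; it is proper if $n<v$. *)

(* Defs.v *)
From mathcomp Require Import all_boot.

Set Implicit Arguments.
Unset Strict Implicit.
Unset Printing Implicit Defensive.

Definition configuration3 (T : finType) (w : nat) (P : {set T})
    (L : {set {set T}}) : Prop :=
  [/\ #|L| = w,
      forall l : {set T}, l \in L -> l \subset P /\ #|l| = 3,
      forall x y : T, x \in P -> y \in P -> x != y ->
        #|[set l in L | (x \in l) && (y \in l)]| <= 1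
    & forall x : T, x \in P -> #|[set l in L | x \in l]| = 3].

Definition subconfiguration3 (T : finType) (L : {set {set T}}) (n : nat)
    (L' : {set {set T}}) : Prop :=
  L' \subset L /\ configuration3 n (cover L') L'.

Definition has_proper_subconfiguration3 (T : finType) (v : nat)
    (L : {set {set T}}) (n : nat) : Prop :=
  n < v /\ exists L' : {set {set T}}, subconfiguration3 L n L'.

(* Main.v *)
(** The complementary set of lines works: a point covered by the subconfiguration
    already has all three of its lines there, so every point on a line outside the
    subconfiguration keeps its three lines in the complement. *)
Require Import Defs.
From mathcomp Require Import all_boot.

(** The lines of [L'] through [x] are among those of [L] through [x], and there are three of each,
    so the two sets coincide. *)
Lemma subconfiguration3_closed (T : finType) (v n : nat) (P : {set T})
    (L L' : {set {set T}}) (x : T) (l : {set T}) :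
  configuration3 v P L -> subconfiguration3 L n L' ->
  x \in cover L' -> l \in L -> x \in l -> l \in L'.
Proof.
move=> [_ Lsub _ Ldeg] [sL'L [_ _ _ L'deg]] xL' lL xl.
have xP : x \in P by have [/subsetP lP _] := Lsub l lL; apply: lP.
have eqS : [set k in L' | x \in k] = [set k in L | x \in k].
  apply/eqP; rewrite eqEcard (L'deg x xL') (Ldeg x xP) leqnn andbT.
  apply/subsetP=> k; rewrite !inE => /andP[kL' ->].
  by rewrite (subsetP sL'L).
have : l \in [set k in L | x \in k] by rewrite inE lL.
by rewrite -eqS inE => /andP[].
Qed.

Lemma subconfiguration3_setD (T : finType) (v n : nat) (P : {set T})
    (L L' : {set {set T}}) :
  configuration3 v P L -> subconfiguration3 L n L' ->
  subconfiguration3 L (v - n) (L :\: L').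
Proof.
move=> confL subL'; have [cardL Lsub Lpair Ldeg] := confL.
have [sL'L [cardL' _ _ _]] := subL'.
have coverP x : x \in cover (L :\: L') -> x \in P.
  case/bigcupP=> l /setDP[lL _] xl.
  by have [/subsetP lP _] := Lsub l lL; apply: lP.
split; first exact: subsetDl.
split.
- by rewrite cardsDS // cardL cardL'.
- move=> l lD; split; first exact: bigcup_sup.
  by have [] := Lsub l (subsetP (subsetDl _ _) l lD).
- move=> x y /coverP xP /coverP yP neq_xy.
  apply: leq_trans (Lpair x y xP yP neq_xy); apply: subset_leq_card.
  by apply/subsetP=> l; rewrite !inE -andbA => /and3P[_ -> ->].
- move=> x xD; rewrite -(Ldeg x (coverP x xD)).
  apply: eq_card => l; rewrite !inE.
  have [xl|] := boolP (x \in l); last by rewrite !andbF.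
  rewrite !andbT; have [lL'|//] := boolP (l \in L').
  (* A line [l] of [L'] through [x] is impossible: [x] would lie in [cover L'], and closedness would
     force into [L'] the line [k] outside [L'] that passes through [x]. *)
  have /bigcupP[k /setDP[kL kL'] xk] := xD.
  have xL' : x \in cover L' by apply/bigcupP; exists l.
  by case/negP: kL'; apply: subconfiguration3_closed confL subL' xL' kL xk.
Qed.

Theorem theorem8 (T : finType) (v n : nat) (P : {set T}) (L : {set {set T}}) :
  configuration3 v P L ->
  0 < n ->
  has_proper_subconfiguration3 v L n ->
  has_proper_subconfiguration3 v L (v - n).
Proof.
move=> confL n_gt0 [lt_nv [L' subL']]; split.
  (* Here [0 < n] matters: for [n = 0] the subconfiguration is empty and its complement is all of
     [L], which is not proper. *)
  by rewrite ltn_subrL n_gt0 (ltn_trans n_gt0 lt_nv).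
by exists (L :\: L'); apply: subconfiguration3_setD confL subL'.
Qed.
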